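(* Let $L=\Pi-\mathbf 1$ be the generator of the discrete immediate exchange model $IEM(1,1)$, acting on functions $f:\mathbb N^2\to\mathbb R$. Then: (1) For each $\alpha\in\{+,-,0\}$, $L$ commutes with the operator $K^{\alpha,2}_1+K^{\alpha,2}_2$ on functions $f:\mathbb N^2\to\mathbb R$. (2) The model is self-dual with self-duality function $D(k_1,k_2;n_1,n_2)=d(k_1,n_1)\,d(k_2,n_2)$, where $$d(k,n)=\begin{cases}1 & \text{if } k=0,\\ 0 & \text{if } k>n,\\ \dfrac{n!}{(n-k)!}\,\dfrac{\Gamma(2)}{\Gamma(2+k)} & \text{otherwise.}\end{cases}$$
   Context: $\mathbb N=\{0,1,2,\dots\}$. Immediate exchange model $IEM(1,1)$: given $(n_1,n_2)\in\mathbb N^2$, let $k_1,k_2$ be independent, $k_i$ uniformly distributed on $\{0,1,\dots,n_i\}$. One update replaces $(n_1,n_2)$ by $(k_2+n_1-k_1,\;k_1+n_2-k_2)$. The transition operator is $$\Pi f(n_1,n_2)=\sum_{k_1=0}^{n_1}\sum_{k_2=0}^{n_2}\frac{1}{(n_1+1)(n_2+1)}\,f(k_2+n_1-k_1,\;k_1+n_2-k_2),$$ and the generator is $L=\Pi-\mathbf 1$ with $\mathbf 1$ the identity (updates occur at the event times of a mean-one Poisson process). Operators: for $\kappa>0$ and $f:\mathbb N\to\mathbb R$, $$K^{+,\kappa}f(n)=(\kappa+n)f(n+1),\quad K^{-,\kappa}f(n)=n f(n-1),\quad K^{0,\kappa}f(n)=\left(\tfrac{\kappa}{2}+n\right)f(n),$$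 where $K^{-,\kappa}f(0)=0$. $K^{\alpha,\kappa}_i$ denotes $K^{\alpha,\kappa}$ acting on the $i$-th variable of a function of two variables. Self-duality with function $D$ means: for all $(k_1,k_2),(n_1,n_2)\in\mathbb N^2$, $\big(L D(\cdot\,;n_1,n_2)\big)(k_1,k_2)=\big(L D(k_1,k_2;\cdot)\big)(n_1,n_2)$. *)

(* Defs.v *)
From HB Require Import structures.
From mathcomp Require Import all_boot all_order all_algebra.
From mathcomp Require Import all_classical all_reals all_analysis.

Set Implicit Arguments.
Unset Strict Implicit.
Unset Printing Implicit Defensive.

Import Order.TTheory GRing.Theory Num.Theory.
Import numFieldNormedType.Exports.

Local Open Scope classical_set_scope.
Local Open Scope ring_scope.

(* Euler's Gamma function; meaningful for 0 < a, where the integral is finite. *)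
Definition Gamma {R : realType} (a : R) : R :=
  Rintegral (@lebesgue_measure R) `]0, +oo[
    (fun x => x `^ (a - 1) * expR (- x)).

(* The nat subtractions below never truncate, since k1 <= n.1 and k2 <= n.2. *)
Definition IEM_Pi {R : realType} (f : nat * nat -> R) : nat * nat -> R :=
  fun n => \sum_(k1 < n.1.+1) \sum_(k2 < n.2.+1)
    1 / ((n.1%:R + 1) * (n.2%:R + 1)) *
    f ((k2 + n.1 - k1)%N, (k1 + n.2 - k2)%N).

Definition IEM_L {R : realType} (f : nat * nat -> R) : nat * nat -> R :=
  fun n => IEM_Pi f n - f n.

Inductive K_index := Kplus | Kminus | Kzero.

(* For Kminus at n = 0 the junk value f 0 (as 0.-1 = 0) is multiplied by 0,
   which is the convention K^- f(0) = 0. *)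
Definition K {R : realType} (alpha : K_index) (kappa : R) (f : nat -> R) :
    nat -> R :=
  fun n => match alpha with
           | Kplus => (kappa + n%:R) * f n.+1
           | Kminus => n%:R * f n.-1
           | Kzero => (kappa / 2 + n%:R) * f n
           end.

Definition on_fst {R : realType} (A : (nat -> R) -> nat -> R)
    (f : nat * nat -> R) : nat * nat -> R :=
  fun n => A (fun m => f (m, n.2)) n.1.

Definition on_snd {R : realType} (A : (nat -> R) -> nat -> R)
    (f : nat * nat -> R) : nat * nat -> R :=
  fun n => A (fun m => f (n.1, m)) n.2.

Definition op_add {R : realType}
    (A B : (nat * nat -> R) -> nat * nat -> R) (f : nat * nat -> R) :
    nat * nat -> R :=
  fun n => A f n + B f n.

Definition op_commute {R : realType}
    (A B : (nat * nat -> R) -> nat * nat -> R) : Prop :=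
  forall f : nat * nat -> R, A (B f) = B (A f).

Definition self_dual {R : realType}
    (A : (nat * nat -> R) -> nat * nat -> R)
    (D : nat * nat -> nat * nat -> R) : Prop :=
  forall k n : nat * nat, A (fun k' => D k' n) k = A (fun n' => D k n') n.

Definition dual_d {R : realType} (k n : nat) : R :=
  if k == 0%N then 1
  else if (n < k)%N then 0
  else n`!%:R / (n - k)`!%:R * (Gamma 2 / Gamma (2 + k%:R)).

Definition dual_D {R : realType} (k n : nat * nat) : R :=
  dual_d k.1 n.1 * dual_d k.2 n.2.

(* Main.v *)
Require Import Defs.
From mathcomp Require Import all_boot all_order all_algebra.
From mathcomp Require Import all_classical all_reals all_analysis.
From mathcomp Require Import measurable_realfun ring zify.

Import Order.TTheory GRing.Theory Num.Theory.
Import numFieldNormedType.Exports.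

Local Open Scope classical_set_scope.
Local Open Scope ring_scope.

(* Multiplied by (n1+1)(n2+1), the transition operator is a sum over splittings
   n1 = a + i, n2 = d + j, where the arguments of f are j + a and i + d. A factor
   such as j + a is distributed over the two splittings; a unit shift of each
   summand then reassembles a splitting of n1 -/+ 1 or n2 -/+ 1 with the constant
   factor n1 + 1 or n2 + 1, which the normalization absorbs. For duality,
   Gamma (2 + k) = (k+1)! gives d(k,n) = 'C(n,k)/(k+1) = 'C(n+1,k+1)/(n+1), and
   the two sides agree after expanding 'C(j + a, k1) 'C(i + d, k2) by Vandermonde
   and summing over i and j separately. *)

(** * Binomial convolution identities *)

(** Double counting: subsets of size [p + q + 1] of [{0, ..., n}], sorted by their [(p + 1)]-st
    smallest element [i]. *)
Lemma sum_bin_mul_bin (n p q : nat) :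
  (\sum_(i < n.+1) 'C(i, p) * 'C(n - i, q) = 'C(n.+1, (p + q).+1))%N.
Proof.
elim: q n => [|q IHq] n.
  rewrite addn0; under eq_bigr do rewrite bin0 muln1.
  elim: n => [|n IHn]; first by rewrite big_ord1 binS !bin0n; case: p.
  by rewrite big_ord_recr /= IHn binS.
elim: n => [|n IHn].
  by rewrite big_ord1 subn0 bin0n muln0 binS !bin0n addnS.
rewrite big_ord_recr /= subnn bin0n muln0 addn0.
under eq_bigr => i _ do rewrite subSn ?leq_ord // binS mulnDr.
by rewrite big_split /= IHn IHq addnS [RHS]binS.
Qed.

(** The right side is the sum that exchanging [(k1, k2)] produces, so this is self-duality cleared
    of denominators. *)
Lemma sum_bin_exchange (n1 n2 k1 k2 : nat) :
  (\sum_(i < n1.+1) \sum_(j < n2.+1)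
      'C(j + (n1 - i), k1) * 'C(i + (n2 - j), k2) =
   \sum_(p < k1.+1) \sum_(q < k2.+1)
      'C(n1.+1, (q + (k1 - p)).+1) * 'C(n2.+1, (p + (k2 - q)).+1))%N.
Proof.
transitivity (\sum_(i < n1.+1) \sum_(j < n2.+1) \sum_(p < k1.+1)
    \sum_(q < k2.+1) ('C(i, q) * 'C(n1 - i, k1 - p)) *
                     ('C(j, p) * 'C(n2 - j, k2 - q)))%N.
  apply: eq_bigr => i _; apply: eq_bigr => j _.
  rewrite -!binomial.Vandermonde big_distrl /=; apply: eq_bigr => p _.
  by rewrite big_distrr /=; apply: eq_bigr => q _; ring.
under eq_bigr do rewrite exchange_big.
rewrite exchange_big; apply: eq_bigr => p _ /=.
under eq_bigr do rewrite exchange_big.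
rewrite exchange_big; apply: eq_bigr => q _ /=.
under eq_bigr do rewrite -big_distrr /=.
by rewrite -big_distrl /= !sum_bin_mul_bin.
Qed.

(** * Weighted sums over splittings *)

(** A splitting [(a, b)] of [n - 1] is reached from [(a + 1, b)] with weight [a + 1] and from
    [(a, b + 1)] with weight [b + 1], in total [n + 1]. *)
Lemma sum_split_lower (R : pzRingType) (g : nat -> nat -> R) (n : nat) :
  \sum_(i < n.+1) ((n - i)%:R * g (n - i).-1 i + i%:R * g (n - i)%N i.-1) =
  n.+1%:R * \sum_(i < n) g (n - i.+1)%N i.
Proof.
rewrite big_split /= big_ord_recr /= subnn mul0r addr0.
rewrite [X in _ + X]big_ord_recl mul0r add0r -big_split mulr_sumr /=.
apply: eq_bigr => i _; rewrite /bump add1n /= -subnS -mulrDl -natrD.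
by congr (_%:R * _); have := ltn_ord i; lia.
Qed.

(** A splitting [(a, b)] of [n + 1] collects weight [a] from [(a - 1, b)] and [b] from
    [(a, b - 1)]. *)
Lemma sum_split_raise (R : pzRingType) (g : nat -> nat -> R) (n : nat) :
  \sum_(i < n.+1)
     ((n - i).+1%:R * g (n - i).+1 i + i.+1%:R * g (n - i)%N i.+1) =
  n.+1%:R * \sum_(i < n.+2) g (n.+1 - i)%N i.
Proof.
transitivity
    (\sum_(i < n.+2) ((n.+1 - i)%:R + i%:R) * g (n.+1 - i)%N i); last first.
  rewrite mulr_sumr; apply: eq_bigr => i _; rewrite -natrD subnK //.
  by rewrite -ltnS.
under [RHS]eq_bigr do rewrite mulrDl.
rewrite !big_split /= [X in _ = X + _]big_ord_recr /= subnn mul0r addr0.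
rewrite [X in _ = _ + X]big_ord_recl mul0r add0r /=.
by congr (_ + _); apply: eq_bigr => i _; rewrite ?subSn // -ltnS.
Qed.

(** * Commutation with the operators [K] *)

(* The term (i, j) is the 2x2 table with rows (n.1 - i, i) and (j, n.2 - j); the
   arguments of f are its column sums. *)
Definition IEM_sum {R : realType} (f : nat * nat -> R) (n : nat * nat) : R :=
  \sum_(i < n.1.+1) \sum_(j < n.2.+1)
    f ((j + (n.1 - i))%N, (i + (n.2 - j))%N).

Lemma IEM_PiE (R : realType) (f : nat * nat -> R) n :
  IEM_Pi f n = IEM_sum f n / (n.1.+1%:R * n.2.+1%:R).
Proof.
rewrite mulrC /IEM_sum mulr_sumr; apply: eq_bigr => i _.
rewrite mulr_sumr; apply: eq_bigr => j _.
by rewrite div1r !natr1 !addnBA // -ltnS.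
Qed.

(** The sums are written out because at [n1 = 0] the first must be empty, whereas [IEM_sum] at
    [0.-1 = 0] is not. *)
Lemma IEM_sum_lower (R : realType) (f : nat * nat -> R) n1 n2 :
  IEM_sum (op_add (on_fst (K Kminus 2)) (on_snd (K Kminus 2)) f) (n1, n2) =
  n1.+1%:R * (\sum_(i < n1) \sum_(j < n2.+1)
                f ((j + (n1 - i.+1))%N, (i + (n2 - j))%N)) +
  n2.+1%:R * (\sum_(i < n1.+1) \sum_(j < n2)
                f ((j + (n1 - i))%N, (i + (n2 - j.+1))%N)).
Proof.
(* Truncated predecessors are harmless: at 0 each has coefficient 0. *)
have natrD_pred (h : nat -> R) a b :
    (a + b)%:R * h (a + b).-1 = a%:R * h (a.-1 + b)%N + b%:R * h (a + b.-1)%N.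
  case: a b => [|a] [|b]; rewrite ?addn0 ?add0n ?mul0r ?addr0 ?add0r //.
  by rewrite natrD mulrDl addSn addnS.
pose g i j a b := f ((j + a)%N, (i + b)%N).
rewrite [X in _ * X + _]exchange_big.
(* The four terms, grouped by column of the table, are regrouped by row, so that one row varies
   while the other stays fixed. *)
transitivity
  (\sum_(j < n2.+1) \sum_(i < n1.+1)
     ((n1 - i)%:R * g i j (n1 - i).-1 (n2 - j)%N +
      i%:R * g i.-1 j (n1 - i)%N (n2 - j)%N) +
   \sum_(i < n1.+1) \sum_(j < n2.+1)
     ((n2 - j)%:R * g i j (n1 - i)%N (n2 - j).-1 +
      j%:R * g i j.-1 (n1 - i)%N (n2 - j)%N)).
  rewrite [X in _ + X]exchange_big -big_split /IEM_sum exchange_big.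
  apply: eq_bigr => j _; rewrite -big_split; apply: eq_bigr => i _ /=.
  rewrite /op_add /on_fst /on_snd /K /=.
  rewrite (natrD_pred (fun m => f (m, _))) (natrD_pred (fun m => f (_, m))) /g.
  ring.
congr (_ + _); rewrite mulr_sumr; apply: eq_bigr => i _.
- by rewrite (sum_split_lower _ (fun a b => g b i a (n2 - i)%N)).
- by rewrite (sum_split_lower _ (fun a b => g i b (n1 - i)%N a)).
Qed.

Lemma IEM_sum_raise (R : realType) (f : nat * nat -> R) n1 n2 :
  IEM_sum (op_add (on_fst (K Kplus 2)) (on_snd (K Kplus 2)) f) (n1, n2) =
  n1.+1%:R * IEM_sum f (n1.+1, n2) + n2.+1%:R * IEM_sum f (n1, n2.+1).
Proof.
pose g i j a b := f ((j + a)%N, (i + b)%N).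
(* The constant 2 gives one unit to each of the two entries of a column, whence the successors in
   the weights. *)
transitivity
  (\sum_(j < n2.+1) \sum_(i < n1.+1)
     ((n1 - i).+1%:R * g i j (n1 - i).+1 (n2 - j)%N +
      i.+1%:R * g i.+1 j (n1 - i)%N (n2 - j)%N) +
   \sum_(i < n1.+1) \sum_(j < n2.+1)
     ((n2 - j).+1%:R * g i j (n1 - i)%N (n2 - j).+1 +
      j.+1%:R * g i j.+1 (n1 - i)%N (n2 - j)%N)).
  rewrite [X in _ + X]exchange_big -big_split /IEM_sum exchange_big.
  apply: eq_bigr => j _; rewrite -big_split; apply: eq_bigr => i _ /=.
  rewrite /op_add /on_fst /on_snd /K /g /= !addSn !addnS !natrD -!natr1.
  ring.
rewrite [X in _ = _ * X + _]exchange_big.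
congr (_ + _); rewrite mulr_sumr; apply: eq_bigr => i _.
- by rewrite (sum_split_raise _ (fun a b => g b i a (n2 - i)%N)).
- by rewrite (sum_split_raise _ (fun a b => g i b (n1 - i)%N a)).
Qed.

(** An exchange conserves [n.1 + n.2], so the two weights have a constant sum. *)
Lemma IEM_sum_zero (R : realType) (f : nat * nat -> R) n :
  IEM_sum (op_add (on_fst (K Kzero 2)) (on_snd (K Kzero 2)) f) n =
  (2 + n.1%:R + n.2%:R) * IEM_sum f n.
Proof.
rewrite mulr_sumr; apply: eq_bigr => i _.
rewrite mulr_sumr; apply: eq_bigr => j _.
have e : (j + (n.1 - i))%:R + (i + (n.2 - j))%:R = n.1%:R + n.2%:R :> R.
  rewrite -!natrD; congr _%:R; have := ltn_ord i; have := ltn_ord j; lia.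
rewrite /op_add /on_fst /on_snd /K /= divff // -addrA -e; ring.
Qed.

Lemma IEM_Pi_commute (R : realType) alpha (f : nat * nat -> R) n :
  let A := op_add (on_fst (K alpha (2 : R))) (on_snd (K alpha (2 : R))) in
  IEM_Pi (A f) n = A (IEM_Pi f) n.
Proof.
case: n => n1 n2.
have nz1 m : 1 + m%:R != 0 :> R by rewrite nat1r pnatr_eq0.
have nz2 m : 2 + m%:R != 0 :> R by rewrite -natrD pnatr_eq0.
have e m : 2 + m%:R = m.+2%:R :> R by rewrite -natrD.
case: alpha => /=; rewrite IEM_PiE /=.
(* [2 + n1] cancels the factor [n1.+2] in the normalization of [IEM_Pi f] at [n1.+1]; likewise for
   [n2]. *)
- rewrite IEM_sum_raise /op_add /on_fst /on_snd /K /= !IEM_PiE /=.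
  by rewrite !e; field; rewrite !nz1 !nz2.
- rewrite IEM_sum_lower /op_add /on_fst /on_snd /K /= !IEM_PiE /=.
  rewrite mulrDl; congr (_ + _).
  + case: n1 => [|n1]; first by rewrite big_ord0 mulr0 !mul0r.
    by rewrite /IEM_sum /= -(e n1); field; rewrite !nz1 !nz2.
  + case: n2 => [|n2].
      by rewrite big1 ?mulr0 ?mul0r // => i _; rewrite big_ord0.
    by rewrite /IEM_sum /= -(e n2); field; rewrite !nz1 !nz2.
- rewrite IEM_sum_zero /op_add /on_fst /on_snd /K /= !IEM_PiE /=.
  by field; rewrite !nz1.
Qed.

Lemma IEM_L_commute (R : realType) alpha :
  op_commute (@IEM_L R)
    (op_add (on_fst (K alpha (2 : R))) (on_snd (K alpha (2 : R)))).
Proof.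
move=> f; apply/funext => n; rewrite {1}/IEM_L IEM_Pi_commute.
rewrite /op_add /on_fst /on_snd /K /IEM_L; case: alpha; ring.
Qed.

(** * The Gamma function at positive integers *)

(* The upper incomplete Gamma function, x |-> \int_x^oo t^n e^-t dt. *)
Fixpoint gamma_tail {R : realType} (n : nat) : R -> R :=
  match n with
  | 0 => fun x => expR (- x)
  | m.+1 => fun x => x ^+ m.+1 * expR (- x) + m.+1%:R * gamma_tail m x
  end.

(** The recursion is integration by parts: one product-rule term cancels the derivative of the
    recursive summand. *)
Lemma is_derive_gamma_tail (R : realType) n (x : R) :
  is_derive x 1 (gamma_tail n) (- (x ^+ n * expR (- x))).
Proof.
elim: n => [|n IHn] /=.
  by apply: is_derive_eq; rewrite expr0 mul1r mulrN1.
rewrite (_ : (fun y => _) =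
    id ^+ n.+1 * (expR \o -%R) + n.+1%:R *: gamma_tail n); last first.
  by apply/funext => y; rewrite !fctE.
apply: is_derive_eq.
rewrite /GRing.scale /= !fctE exprS; ring.
Qed.

Lemma cvg_exprn_expRN (R : realType) n :
  x ^+ n * expR (- x) @[x --> +oo%R] --> (0 : R).
Proof.
(* The upper bound comes from [x ^+ n.+1 / n.+1! <= expR x]. *)
apply: (@squeeze_cvgr _ _ _ _ (fun=> 0) (fun x => n.+1`!%:R * x^-1)).
- near=> x.
  have x0 : 0 < x by near: x; exact: nbhs_pinfty_gt.
  rewrite mulr_ge0 ?exprn_ge0 ?expR_ge0 ?(ltW x0) //=.
  rewrite expRN ler_pdivrMr ?expR_gt0 // mulrAC ler_pdivlMr // -exprSr.
  rewrite -ler_pdivrMl ?ltr0n ?fact_gt0 // mulrC.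
  by rewrite (le_trans _ (expR_ge1Dxn n (ltW x0))) // lerDr.
- exact: cvg_cst.
- rewrite -(mulr0 n.+1`!%:R); apply: cvgMl_tmp.
  apply/gtr0_cvgV0; last exact: cvg_id.
  exact: nbhs_pinfty_gt.
Unshelve. all: by end_near. Qed.

Lemma cvg_gamma_tail (R : realType) n :
  gamma_tail n x @[x --> +oo%R] --> (0 : R).
Proof.
elim: n => [|n IHn] /=; first exact: cvgr_expR.
rewrite -[X in _ --> X](addr0 0); apply: cvgD; first exact: cvg_exprn_expRN.
by rewrite -[X in _ --> X](mulr0 n.+1%:R); apply: cvgMl_tmp.
Qed.

Lemma gamma_tail_at0 (R : realType) n : gamma_tail n (0 : R) = n`!%:R.
Proof.
elim: n => [|n IHn] /=; first by rewrite oppr0 expR0.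
by rewrite expr0n /= mul0r add0r IHn factS natrM.
Qed.

Lemma Gamma_natS (R : realType) n : Gamma (n.+1%:R : R) = n`!%:R.
Proof.
have dG (x : R) : is_derive x 1 (fun x => - gamma_tail n x) (x ^+ n * expR (- x)).
  rewrite -[X in is_derive _ _ _ X]opprK; apply: is_deriveN.
  exact: is_derive_gamma_tail.
rewrite /Gamma.
(* The added endpoint 0 is a null set, and for [0 <= x] the real power is the natural one. *)
transitivity (Rintegral (@lebesgue_measure R) `[0, +oo[%classic
    (fun x => x ^+ n * expR (- x))).
  rewrite -[n.+1%:R]natr1 addrK.
  rewrite /Rintegral integral_itv_obnd_cbnd.
    congr fine; apply: eq_integral => x; rewrite inE /= in_itv /= andbT => x0.
    by rewrite powR_mulrn.
  apply/measurable_EFinP/measurable_funTS/measurable_funM.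
    exact: measurable_powR.
  by apply: measurableT_comp => //; exact: measurable_funN.
rewrite (@Rintegral_ge0_continuous_FTC2y _ _ (fun x => - gamma_tail n x) 0 0).
- by rewrite gamma_tail_at0 opprK add0r.
- by move=> x x0; rewrite mulr_ge0 ?exprn_ge0 ?expR_ge0.
- apply: continuous_subspaceT => x; apply: cvgM.
    exact: exprn_continuous.
  apply: (@continuous_comp _ _ _ (fun x : R => - x) expR).
    exact: oppr_continuous.
  exact: continuous_expR.
- by rewrite -oppr0; apply: cvgN; exact: cvg_gamma_tail.
- by move=> x _; case: (dG x).
- apply: cvg_at_right_filter.
  suff : {for 0, continuous (fun x : R => - gamma_tail n x)} by [].
  by apply/differentiable_continuous/derivable1_diffP; case: (dG 0).
- by move=> x _; rewrite derive1E; case: (dG x).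
Qed.

(** * Self-duality *)

Lemma dual_d_binS (R : realType) k n :
  dual_d k n = 'C(n.+1, k.+1)%:R / n.+1%:R :> R.
Proof.
have nz m : m.+1%:R != 0 :> R by rewrite pnatr_eq0.
have fz m : m`!%:R != 0 :> R by rewrite pnatr_eq0 -lt0n fact_gt0.
rewrite /dual_d; case: ifPn => [/eqP ->|_]; first by rewrite bin1 divff.
case: ltnP => [nk|kn]; first by rewrite bin_small ?mul0r.
rewrite -[2 + k%:R]natrD !Gamma_natS.
apply: (mulIf (nz n)); rewrite divfK //.
apply: (mulIf (fz (n - k)%N)); apply: (mulIf (fz k.+1)).
have := @bin_fact n.+1 k.+1; rewrite subSS ltnS kn => /(_ isT) e.
rewrite -[RHS]mulrA -!natrM [(_ * k.+1`!)%N]mulnC e (factS n) natrM -[1`!]/1%N.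
field.
by rewrite !fz.
Qed.

Lemma self_dual_IEM_L (R : realType) : self_dual (@IEM_L R) (@dual_D R).
Proof.
move=> [k1 k2] [n1 n2]; rewrite /IEM_L /dual_D /=; congr (_ - _).
rewrite !IEM_PiE /IEM_sum /=.
have nz m : m.+1%:R != 0 :> R by rewrite pnatr_eq0.
(* Each side uses the form of [d] whose denominator stays fixed: [n + 1] while [k] is exchanged,
   [k + 1] while [n] is. *)
have dual_d_bin k n : dual_d k n = 'C(n, k)%:R / k.+1%:R :> R.
  rewrite dual_d_binS; apply: (mulIf (nz n)); rewrite divfK // mulrAC.
  by apply: (mulIf (nz k)); rewrite divfK // -!natrM mulnC -mul_bin_diag mulnC.
under eq_bigr do under eq_bigr do
  rewrite !dual_d_binS mulf_div -!natrM.
under [in RHS]eq_bigr do under eq_bigr do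
  rewrite !dual_d_bin mulf_div -!natrM.
under eq_bigr do rewrite -mulr_suml -natr_sum.
under [in RHS]eq_bigr do rewrite -mulr_suml -natr_sum.
rewrite -!mulr_suml -!natr_sum sum_bin_exchange !natrM.
by rewrite mulrAC.
Qed.

Theorem theorem2p1 (R : realType) :
  (forall alpha : K_index,
     op_commute (@IEM_L R)
       (op_add (on_fst (K alpha (2 : R))) (on_snd (K alpha (2 : R)))))
  /\ self_dual (@IEM_L R) (@dual_D R).
Proof.
by split; [exact: IEM_L_commute | exact: self_dual_IEM_L].
Qed.
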